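(* For a positive integer $n$ define the polynomials $C_n(x)=x(1+x)^{n-1}$, $S_n(x)=x(1+x)(1+x^2)^{(n-2)/2}$ if $n$ is even and $S_n(x)=x(1+x^2)^{(n-1)/2}$ if $n$ is odd, and $L^\times_n(x)=\tfrac12(C_n(x)-S_n(x))$ (these are the generating functions by length of all compositions, symmetric compositions, and asymmetric lexicographic minimal compositions of size $n$, respectively). Let $R_n(x)=\sum_{\rho} x^{l(\rho)}$ over normalised compositions $\rho$ of size $n$, and let $R^1_n(x)=\sum_\rho x^{l(\rho)}$ over normalised compositions $\rho$ of size $n$ whose first factor in the irreducible factorisation is asymmetric and all remaining factors (if any) are symmetric. Then $$R^1_n(x)=\sum_{\substack{k\ge0,\ 1=d_0\mid d_1\mid\dots\mid d_k\mid n\\ d_i\ne d_{i+1}\ (0\le i\le k-1)}}(-1)^k\,L^\times_{n/d_k}(x^{d_k})\prod_{i=0}^{k-1}\frac{C_{d_{i+1}/d_i}(x^{d_i})}{x^{d_i}}$$ and $$R_n(x)=\sum_{\substack{k\ge0,\ d_1\mid d_2\mid\dots\mid d_{k+1}=n\\ d_i\ne d_{i+1}\ (1\le i\le k)}}S_{d_1}(x)\prod_{i=1}^{k}\frac{R^1_{d_{i+1}/d_i}(x^{d_i})}{x^{d_i}}.$$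
   Context: A composition $\alpha=(a_1,\dots,a_k)$ of a positive integer $m$ is a list of positive integers with sum $m$; $l(\alpha)=k$ is its length and $|\alpha|=m$ its size. Near concatenation: $(a_1,\dots,a_k)\odot(b_1,\dots,b_\ell)=(a_1,\dots,a_{k-1},a_k+b_1,b_2,\dots,b_\ell)$; $\beta^{\odot n}$ is the $n$-fold near concatenation of $\beta$ with itself; $\cdot$ is ordinary concatenation. The composition of compositions is $\alpha\circ\beta=\beta^{\odot a_1}\cdots\beta^{\odot a_k}$ (associative, neutral element $(1)$). A factorisation $\alpha=\beta\circ\gamma$ is trivial if one of $\beta,\gamma$ equals $(1)$, or both have length $1$, or both have all components equal to $1$. A factorisation $\alpha=\alpha_1\circ\dots\circ\alpha_k$ is irreducible if no $\alpha_i\circ\alpha_{i+1}$ is trivial and each $\alpha_i$ admits only trivial factorisations; every composition has a unique irreducible factorisation. The reversal of $(a_1,\dots,a_k)$ is $\alpha^*=(a_k,\dots,a_1)$; $\alpha$ is symmetric if $\alpha=\alpha^*$, asymmetric otherwise. Compositions of equal length are ordered lexicographically; $\alpha$ is lexicographic minimal if $\alpha\le\alpha^*$. A composition is normalised if all factors of its irreducible factorisation are lexicographic minimal. In the sums, $d_i\mid d_{i+1}$ denotes divisibility of positive integers.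
   Formalization: In the formula for R^1_n the denominators x^{d_i} are replaced by x^{d_{i+1}}, since the printed identity fails at n = 6 (coefficient of x^5 is 1 instead of 2); the formula for R_n is unchanged, and the parenthetical on generating functions is not part of the statement. *)

(* Defs.v *)
From mathcomp Require Import all_boot all_order all_algebra.
From mathcomp Require Import fraction.
From mathcomp Require Import boolp classical_sets fsbigop.

Set Implicit Arguments.
Unset Strict Implicit.
Unset Printing Implicit Defensive.

Import Order.TTheory GRing.Theory.
Local Open Scope classical_set_scope.
Local Open Scope ring_scope.

Definition is_composition (s : seq nat) : bool :=
  (s != [::]) && all (leq 1) s.

Definition is_composition_of (n : nat) (s : seq nat) : bool :=
  is_composition s && (sumn s == n).

(* Meaningful on nonempty sequences only. *)
Definition near_cat (s t : seq nat) : seq nat :=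
  take (size s).-1 s ++ (last 0%N s + head 0%N t)%N :: behead t.

(* Meaningful for a positive exponent only. *)
Definition near_pow (b : seq nat) (n : nat) : seq nat :=
  iter n.-1 (near_cat b) b.

Definition circ (a b : seq nat) : seq nat :=
  flatten [seq near_pow b i | i <- a].

Definition trivial_pair (b c : seq nat) : bool :=
  [|| b == [:: 1%N], c == [:: 1%N],
      (size b == 1%N) && (size c == 1%N) |
      all (pred1 1%N) b && all (pred1 1%N) c].

Definition only_trivial_factorisations (a : seq nat) : Prop :=
  forall b c : seq nat, is_composition b -> is_composition c ->
    a = circ b c -> trivial_pair b c.

(* [fs] must be nonempty: the composition (1) is its own single factor.
   Since (1) is neutral for [circ], the fold is the product of [fs].
   [sorted] tests consecutive pairs only. *)
Definition irreducible_factorisation (fs : seq (seq nat)) (a : seq nat) : Prop :=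
  [/\ fs != [::],
      all is_composition fs,
      a = foldr circ [:: 1%N] fs,
      sorted (fun b c => ~~ trivial_pair b c) fs
    & forall b, b \in fs -> only_trivial_factorisations b].

Definition symmetric_comp (a : seq nat) : bool := a == rev a.

Definition lex_minimal (a : seq nat) : bool :=
  ((a : seqlexi nat) <= (rev a : seqlexi nat))%O.

(* Irreducible factorisations exist and are unique, so "the" factorisation
   of [a] is rendered by an existential. *)
Definition normalised (a : seq nat) : Prop :=
  exists2 fs, irreducible_factorisation fs a & all lex_minimal fs.

Definition asymmetric_then_symmetric (a : seq nat) : Prop :=
  exists2 fs, irreducible_factorisation fs a &
    ~~ symmetric_comp (head [::] fs) && all symmetric_comp (behead fs).

Definition Cpoly (n : nat) : {poly rat} := 'X * (1 + 'X) ^+ (n - 1).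

Definition Spoly (n : nat) : {poly rat} :=
  if odd n then 'X * (1 + 'X^2) ^+ ((n - 1) %/ 2)
  else 'X * (1 + 'X) * (1 + 'X^2) ^+ ((n - 2) %/ 2).

Definition Lxpoly (n : nat) : {poly rat} := 2^-1 *: (Cpoly n - Spoly n).

(* Generating function by length.  A sum over [\in] is a finitely supported
   sum; every index set used here and below is finite for n > 0. *)
Definition length_gf (A : set (seq nat)) : {poly rat} :=
  \sum_(rho \in A) ('X^(size rho) : {poly rat}).

Definition Rpoly (n : nat) : {poly rat} :=
  length_gf [set rho | is_composition_of n rho /\ normalised rho].

Definition R1poly (n : nat) : {poly rat} :=
  length_gf [set rho | [/\ is_composition_of n rho, normalised rho
                         & asymmetric_then_symmetric rho]].

Definition strict_divisor_chain (d : seq nat) : bool :=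
  all (leq 1) d && sorted (fun a b => (a %| b)%N && (a != b)) d.

(* [chains_from1 n] lists the chains (d_0, ..., d_k), with d_0 = 1 and
   d_k | n; [chains_to n] lists the chains (d_1, ..., d_(k+1)) with
   d_(k+1) = n.  In both cases k is one less than the size. *)
Definition chains_from1 (n : nat) : set (seq nat) :=
  [set d | [/\ strict_divisor_chain d, head 0%N d = 1%N & (last 0%N d %| n)%N]].

Definition chains_to (n : nat) : set (seq nat) :=
  [set d | strict_divisor_chain d /\ last 0%N d = n].

(* p(x^m) as a rational function. *)
Definition at_Xn (p : {poly rat}) (m : nat) : {fraction {poly rat}} :=
  tofrac (p \Po 'X^m).

(* Denominators: l(a o b) = l(a) + |a| * l(b) - |a|, so prefixing a composition
   of size d_(i+1) / d_i to one counted at x^(d_(i+1)) divides by x^(d_(i+1));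
   hence the formula for R1 has denominators x^(d_(i+1)).  The source prints
   x^(d_i) there, which fails for n = 6; in the formula for R the printed
   denominators x^(d_i) are right. *)
Definition Xpow (m : nat) : {fraction {poly rat}} := tofrac 'X^m.

(* Main.v *)
(** A composition of size n is encoded by the word of n - 1 bits marking its
    partial sums.  In this encoding [circ a b] becomes the interleaving
    [v x1 v x2 ... xk v] of the word [x1 ... xk] of [a] with the word [v] of [b],
    and reversal becomes reversal.

    An interleaving determines both factors once the size of one is known.  If a
    word has right factors of sizes r and s, neither dividing the other, then by
    the Chinese remainder theorem both are constant words over a common right
    factor of size gcd(r, s).  Hence an asymmetric word has exactly one right
    factor that is asymmetric while all its own proper right factors are
    symmetric; these are the words of compositions whose first irreducible
    factor is asymmetric and all others symmetric, and reversal pairs the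
    normalised ones with the others.

    Splitting off this factor gives
      L_n(x) = sum_(d | n) C_d(x) R1_(n/d)(x^d) / x^d,
      R_n(x) = S_n(x) + sum_(d | n, d < n) R_d(x) R1_(n/d)(x^d) / x^d.
    Unfolding the second recurrence yields the second formula.  The first is
    solved by the inverse of the kernel C_(e/d)(x^d) / x^e in the incidence
    algebra of divisibility, which is the alternating sum over chains. *)

Require Import Defs.
From mathcomp Require Import all_boot all_order all_algebra.
From mathcomp Require Import fraction.
From mathcomp Require Import boolp classical_sets fsbigop.
From mathcomp Require Import zify.

Set Implicit Arguments.
Unset Strict Implicit.
Unset Printing Implicit Defensive.

Import GRing.Theory.
Local Open Scope nat_scope.

(** * Interleaving of words *)

Fixpoint interleave (u v : bitseq) : bitseq :=
  if u is x :: u' then v ++ x :: interleave u' v else v.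

Local Infix "##" := interleave (at level 40, left associativity).

Lemma size_interleave u v : (size (u ## v)).+1 = (size u).+1 * (size v).+1.
Proof. by elim: u => [|x u IH] /=; rewrite ?mul1n // size_cat /=; nia. Qed.

Lemma count_interleave u v :
  count id (u ## v) = count id u + (size u).+1 * count id v.
Proof. by elim: u => [|x u IH] /=; rewrite ?mul1n // count_cat /= IH; lia. Qed.

Lemma all_interleave (a : pred bool) u v : all a (u ## v) = all a u && all a v.
Proof.
elim: u => [//|x u IH] /=; rewrite all_cat /= IH.
by case: (all a v); rewrite ?andbT ?andbF.
Qed.

Lemma interleave_nil u : u ## [::] = u.
Proof. by elim: u => //= x u ->. Qed.

Lemma interleave_cat u1 x u2 v :
  (u1 ++ x :: u2) ## v = (u1 ## v) ++ x :: (u2 ## v).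
Proof. by elim: u1 => //= y u1 ->; rewrite -catA. Qed.

Lemma interleaveA u v w : u ## v ## w = u ## (v ## w).
Proof. by elim: u => //= x u <-; rewrite interleave_cat. Qed.

Lemma rev_interleave u v : rev (u ## v) = rev u ## rev v.
Proof.
elim: u => //= x u IH.
by rewrite rev_cat rev_cons cat_rcons IH rev_cons -cats1 interleave_cat.
Qed.

Lemma cat_cons_inj (v v' : bitseq) x x' t t' : size v = size v' ->
  v ++ x :: t = v' ++ x' :: t' -> [/\ v = v', x = x' & t = t'].
Proof. by move=> sv /eqP; rewrite eqseq_cat // => /andP[/eqP-> /eqP[-> ->]]. Qed.

Lemma interleave_inj u v u' v' :
  size v = size v' -> u ## v = u' ## v' -> u = u' /\ v = v'.
Proof.
move=> sv; have := sv; elim: u u' => [|x u IH] [|x' u'] //= _.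
- by move=> /(congr1 size); rewrite size_cat /=; lia.
- by move=> /(congr1 size); rewrite size_cat /=; lia.
- by case/(cat_cons_inj sv) => _ -> /IH[] // -> ->.
Qed.

(** Because [(size v).+1] divides [(size v').+1], the letter of [u'] after the first copy of [v'] is
    also a letter of [u]. Cutting [u] there shows that [v'] is a prefix of [u] interleaved with [v];
    induction on [u'] treats the rest. *)
Lemma interleave_dvd_factor u v u' v' :
  u ## v = u' ## v' -> (size v).+1 %| (size v').+1 ->
  exists2 d, v' = d ## v & u = u' ## d.
Proof.
move=> + /dvdnP[k kE]; elim: u' u => [|x u' IH] u /= E.
  by exists u.
have k0 : 0 < k by case: k kE.
have := congr1 size E; rewrite size_cat /= => sE.
have suv := size_interleave u v.
have su : k.-1 < size u by nia.
have uE : u = take k.-1 u ++ nth false u k.-1 :: drop k u.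
  by rewrite -[k in drop k u](prednK k0) -drop_nth // cat_take_drop.
move: E; rewrite {1}uE interleave_cat => /cat_cons_inj[].
  apply: succn_inj; rewrite size_interleave size_takel 1?ltnW //.
  by rewrite prednK.
move=> t1 t2 /IH [d v'E dE]; exists d => //=.
rewrite uE t2 dE; congr (_ ++ _).
by move: t1; rewrite v'E => /interleave_inj[].
Qed.

(** Positions are numbered from 1, so that divisibility of [p] is meaningful. *)
Definition cut (w : bitseq) (p : nat) : bool := nth false w p.-1.

Lemma cut_eq w w' : size w = size w' ->
  (forall p, 0 < p <= size w -> cut w p = cut w' p) -> w = w'.
Proof.
by move=> sw H; apply: (eq_from_nth (x0 := false)) => // i iw; apply: (H i.+1).
Qed.

Lemma cut_interleave u v p : 0 < p <= size (u ## v) ->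
  cut (u ## v) p = if (size v).+1 %| p then cut u (p %/ (size v).+1)
                   else cut v (p %% (size v).+1).
Proof.
elim: u p => [|x u IH] p /=.
  move=> /andP[p0 ps]; rewrite gtnNdvd // modn_small //.
rewrite size_cat /= => /andP[p0 pu]; rewrite /cut nth_cat.
case: (ltngtP p (size v).+1) => pv.
- have -> : p.-1 < size v by lia.
  by rewrite gtnNdvd // modn_small.
- have -> : p.-1 < size v = false by lia.
  have [q qE q0] : exists2 q, p = q + (size v).+1 & 0 < q.
    by exists (p - (size v).+1); lia.
  rewrite qE (_ : (q + _).-1 - size v = q) ?addnS /=; last by lia.
  rewrite -(prednK q0) /= -/(cut (u ## v) q) IH; last by lia.
  rewrite prednK // -addnS dvdn_addl // modnDr divnDr // divnn /= addn1 /cut.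
  case: ifP => // /dvdnP[k kE]; rewrite kE mulnK //=.
  by case: k kE => [|k] kE; [lia|].
- rewrite pv ltnn /= subnn /= dvdnn divnn /=; by [].
Qed.

Lemma interleave_of_period w r : 0 < r -> r %| (size w).+1 ->
  (forall p, 0 < p <= size w -> ~~ (r %| p) -> cut w p = cut w (p %% r)) ->
  w = mkseq (fun i => cut w (i.+1 * r)) ((size w).+1 %/ r).-1 ## take r.-1 w.
Proof.
move=> r0 rw H.
have rle : r <= (size w).+1 by apply: dvdn_leq.
have q0 : 0 < (size w).+1 %/ r by rewrite divn_gt0.
have sv : (size (take r.-1 w)).+1 = r by rewrite size_takel ?prednK //; lia.
have sE : size w = size (mkseq (fun i => cut w (i.+1 * r)) ((size w).+1 %/ r).-1 ## take r.-1 w).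
  by apply: succn_inj; rewrite size_interleave sv size_mkseq prednK // divnK.
apply: cut_eq => // p pw; rewrite cut_interleave -?sE // sv.
case: ifPn => rp.
  have [k kE] := dvdnP rp; rewrite kE mulnK // {1 2}/cut.
  rewrite nth_mkseq /cut; first by case: k kE => //; lia.
  have kr : k < (size w).+1 %/ r by rewrite ltn_divRL //; lia.
  by case: k kE kr => [|k] /=; lia.
rewrite H // /cut nth_take //.
by have := ltn_mod p r; move: rp; rewrite /dvdn; case: (p %% r) => //=; lia.
Qed.

(** * Right factors of incomparable sizes *)

Lemma chinese_gcd r s p p' : 0 < r -> 0 < s -> p = p' %[mod gcdn r s] ->
  exists2 q, q < lcmn r s & q = p %[mod r] /\ q = p' %[mod s].
Proof.
move=> r0 s0 pp'; have l0 : 0 < lcmn r s by rewrite lcmn_gt0 r0.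
(* Bezout: [a * r = b * s + gcdn r s], so shifting [p] by a multiple of [a * r] reaches the residue
   of [p'] modulo [s]. *)
have [a b abE _] := egcdnP s r0.
(* The term [p * s], a multiple of the gcd, keeps the subtraction from being truncated. *)
have /dvdnP[k kE] : gcdn r s %| p' + p * s - p.
  rewrite -eqn_mod_dvd; last by nia.
  rewrite -modnDmr -modnMmr (eqP (dvdn_gcdr r s : s %% gcdn r s == 0)).
  by rewrite muln0 mod0n addn0 pp'.
exists ((p + r * (a * k)) %% lcmn r s); first by rewrite ltn_mod.
rewrite !modn_dvdm ?dvdn_lcml ?dvdn_lcmr //; split.
  by rewrite -modnDmr modnMr addn0.
have -> : p + r * (a * k) = p' + (p + b * k) * s by nia.
by rewrite -modnDmr modnMl addn0.
Qed.

(** For incomparable sizes [r], [s] of the right factors, the Chinese remainder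
    theorem links [p] to [p'] whenever [p = p'] modulo [gcd r s], [~~ (r %| p)]
    and [~~ (s %| p')].  So the cuts at nonmultiples of [gcd r s] are periodic
    modulo [gcd r s], and those at its multiples outside [lcm r s] all agree. *)
Lemma interleave_incomparable u v u' v' :
    u ## v = u' ## v' ->
    ~~ ((size v).+1 %| (size v').+1) -> ~~ ((size v').+1 %| (size v).+1) ->
  exists x B d e d' e', [/\ v = e ## B, v' = e' ## B,
    [/\ all (pred1 x) e, all (pred1 x) e', all (pred1 x) d & all (pred1 x) d'],
    d != [::] & exists2 A, u = A ## d & u' = A ## d'].
Proof.
set w := u ## v => wE'; have wE : w = u ## v by [].
set r := (size v).+1; set s := (size v').+1 => rs sr.
have rw : r %| (size w).+1 by rewrite wE size_interleave dvdn_mull.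
have sw : s %| (size w).+1 by rewrite wE' size_interleave dvdn_mull.
have Hr p : 0 < p <= size w -> ~~ (r %| p) -> cut w p = cut v (p %% r).
  by move=> pw /negPf rp; rewrite wE cut_interleave -?wE // rp.
have Hs p : 0 < p <= size w -> ~~ (s %| p) -> cut w p = cut v' (p %% s).
  by move=> pw /negPf sp; rewrite wE' cut_interleave -?wE' // sp.
move: wE; clearbody w => wE.
set g := gcdn r s; set l := lcmn r s.
have g0 : 0 < g by rewrite gcdn_gt0.
have l0 : 0 < l by rewrite lcmn_gt0.
have gr : g %| r := dvdn_gcdl r s.
have gs : g %| s := dvdn_gcdr r s.
have rl : r %| l := dvdn_lcml r s.
have sl : s %| l := dvdn_lcmr r s.
have lw : l %| (size w).+1 by rewrite dvdn_lcm rw.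
have lle : l <= (size w).+1 by apply: dvdn_leq.
have ltgr : g < r.
  rewrite ltn_neqAle (dvdn_leq _ gr) // andbT; apply: contraNneq rs => gE.
  by rewrite -/r -/s -gE.
have ltgs : g < s.
  rewrite ltn_neqAle (dvdn_leq _ gs) // andbT; apply: contraNneq sr => gE.
  by rewrite -/r -/s -gE.
have lerl : r <= l by apply: dvdn_leq.
have lesl : s <= l by apply: dvdn_leq.
have link p p' : 0 < p <= size w -> 0 < p' <= size w -> ~~ (r %| p) ->
    ~~ (s %| p') -> p = p' %[mod g] -> cut w p = cut w p'.
  move=> pw pw' rp sp' /(chinese_gcd (ltn0Sn _) (ltn0Sn _))[q ql [qr qs]].
  (* Neither [r] nor [s] divides [q], so [q] is nonzero and its cut can be read from both
     factorisations. *)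
  have rq : ~~ (r %| q) by rewrite /dvdn /r qr.
  have sq : ~~ (s %| q) by rewrite /dvdn /s qs.
  have qw : 0 < q <= size w.
    apply/andP; split; last by rewrite -ltnS (leq_trans ql lle).
    rewrite lt0n; by apply: contraNneq rq => ->; rewrite dvdn0.
  by rewrite Hr // -qr -Hr // Hs // qs -Hs.
have lmin p : r %| p -> s %| p -> l %| p by move=> rp sp; rewrite dvdn_lcm rp.
have gw : 0 < g <= size w.
  by rewrite g0 -ltnS (leq_trans ltgr) // (leq_trans lerl).
clearbody g l.
have Pg p : 0 < p <= size w -> ~~ (g %| p) -> cut w p = cut w (p %% g).
  move=> pw gp; have gp' : 0 < p %% g by rewrite lt0n.
  apply: link => //.
  - by rewrite gp' (leq_trans (leq_mod _ _)) //; case/andP: pw.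
  - by apply: contra gp; apply: dvdn_trans.
  - apply: contra gp => /(dvdn_trans gs); rewrite /dvdn modn_mod //.
  - by rewrite modn_mod.
(* Position [g] is divisible by neither [r] nor [s], and at least one of them does not divide [p];
   so [link] applies in one of its two orientations. *)
have Pc p : 0 < p <= size w -> g %| p -> ~~ (l %| p) -> cut w p = cut w g.
  move=> pw gp lp; have pg : p = g %[mod g] by rewrite modnn; apply/eqP.
  case: (boolP (r %| p)) => rp.
    apply/esym/link => //; first by rewrite gtnNdvd.
    by apply: contra lp; apply: lmin.
  by apply: link => //; rewrite gtnNdvd.
have gl : g %| l := dvdn_trans gr rl.
(* The word splits at [l] as [A ## V], then [V] splits at [g] as [U ## B]. The letters of [U] sit at
   multiples of [g] below [l], so [Pc] makes [U] constant. *)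
have := @interleave_of_period w l l0 lw.
have sV : (size (take l.-1 w)).+1 = l by rewrite size_takel ?prednK // -ltnS prednK.
set A := mkseq _ _; set V := take l.-1 w => wAV.
have {}wAV : w = A ## V.
  apply: wAV => p pw lp.
  have pl0 : 0 < p %% l by rewrite lt0n.
  have plw : 0 < p %% l <= size w by rewrite pl0 (leq_trans (leq_mod _ _)) //; case/andP: pw.
  case: (boolP (g %| p)) => gp.
    rewrite Pc // [RHS]Pc //; first by rewrite /dvdn modn_dvdm //.
    by rewrite /dvdn modn_mod.
  rewrite Pg // [RHS]Pg //; first by rewrite modn_dvdm.
  by rewrite /dvdn modn_dvdm.
have cV p : 0 < p < l -> cut V p = cut w p.
  by move=> pl; rewrite /cut nth_take //; clear -pl; lia.
have := @interleave_of_period V g g0; rewrite sV => /(_ gl).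
have sB : (size (take g.-1 V)).+1 = g.
  by rewrite size_takel ?prednK // -ltnS sV prednK // dvdn_leq.
set U := mkseq _ _; set B := take g.-1 V => VUB.
have {}VUB : V = U ## B.
  apply: VUB => p pV gp.
  have gp' : 0 < p %% g by rewrite lt0n.
  have {}pV : 0 < p < l by rewrite -sV ltnS.
  have /andP[p0 pl] := pV.
  rewrite !cV ?gp' ?(leq_ltn_trans (leq_mod _ _) pl) //; apply: Pg => //.
  by rewrite p0 -ltnS (leq_trans pl).
have Ux : all (pred1 (cut w g)) U.
  apply/(all_nthP false) => i; rewrite size_mkseq => il.
  rewrite nth_mkseq //=; apply/eqP.
  have igl : i.+1 * g < l.
    by rewrite -ltn_divRL //; move: il; case: (l %/ g).
  rewrite cV ?igl ?andbT ?muln_gt0 //; apply: Pc.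
  - by rewrite muln_gt0 g0 /= -ltnS (leq_trans igl).
  - by rewrite dvdn_mull.
  - by rewrite gtnNdvd // muln_gt0.
(* Since [r %| l] and [g %| r], the word [v] lies between [V] and [B]: [V = d ## v] and
   [v = e ## B]. Hence [U = d ## e], and [d], [e] inherit constancy; likewise for [v']. *)
have [||d VE uE] := @interleave_dvd_factor u v A V; rewrite ?sV -?wE //.
have [||d' VE' uE'] := @interleave_dvd_factor u' v' A V; rewrite ?sV -?wE' //.
have [||e vE UE] := @interleave_dvd_factor U B d v; rewrite ?sB -?VUB //.
have [||e' vE' UE'] := @interleave_dvd_factor U B d' v'; rewrite ?sB -?VUB //.
move: (Ux) (Ux); rewrite {1}UE {1}UE' !all_interleave => /andP[dx ex] /andP[d'x e'x].
exists (cut w g), B, d, e, d', e'; split => //; last by exists A.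
(* An empty [d] would give [V = v], so [l = r] and [s] would divide [r]. *)
apply: contraNneq sr => d0; move: VE; rewrite d0 /= => VE.
by rewrite -/r -/s /r -VE sV.
Qed.

(** * Factorisations of words *)

Definition prodw (fs : seq bitseq) : bitseq := foldr interleave [::] fs.

Definition palin (w : bitseq) : bool := w == rev w.

(** Word form of [trivial_pair]: the empty word is the composition (1), an all-[false] word has
    length 1, an all-[true] word has all components 1. *)
Definition trivw (b c : bitseq) : bool :=
  [|| b == [::], c == [::],
      all (pred1 false) b && all (pred1 false) c |
      all (pred1 true) b && all (pred1 true) c].

Definition primw (w : bitseq) : Prop := forall b c, w = b ## c -> trivw b c.

Definition factorisation (fs : seq bitseq) (w : bitseq) : Prop :=
  [/\ fs != [::], w = prodw fs, sorted (fun b c => ~~ trivw b c) fs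
    & forall b, b \in fs -> primw b].

(** Describes asymmetric-then-symmetric words without mentioning a factorisation, through proper
    right factors alone. *)
Definition minasym (w : bitseq) : Prop :=
  ~~ palin w /\ forall u v, w = u ## v -> u != [::] -> palin v.

Lemma interleave_eq0 u v : (u ## v == [::]) = (u == [::]) && (v == [::]).
Proof. by case: u => [|x u] //; case: v. Qed.

Lemma size_right_factor u v : u != [::] -> size v < size (u ## v).
Proof. by case: u => //= x u _; rewrite size_cat /=; lia. Qed.

Lemma size_left_factor u v : v != [::] -> size u < size (u ## v).
Proof. by have := size_interleave u v; case: v => //= x v; nia. Qed.

Lemma prodw_cat fs gs : prodw (fs ++ gs) = prodw fs ## prodw gs.
Proof. by elim: fs => //= f fs ->; rewrite interleaveA. Qed.

Lemma palin_interleave u v : palin (u ## v) = palin u && palin v.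
Proof.
rewrite /palin rev_interleave; apply/eqP/andP => [/interleave_inj[]|[/eqP<- /eqP<-]//].
  by rewrite size_rev.
by move=> <- <-; rewrite !eqxx.
Qed.

Lemma palin_rev w : palin (rev w) = palin w.
Proof. by rewrite /palin revK eq_sym. Qed.

Lemma palin_const x w : all (pred1 x) w -> palin w.
Proof. by move=> /all_pred1P ->; rewrite /palin rev_nseq. Qed.

Lemma palin_prodw fs : palin (prodw fs) = all palin fs.
Proof. by elim: fs => //= f fs <-; rewrite palin_interleave. Qed.

Lemma asym_neq0 w : ~~ palin w -> w != [::].
Proof. by apply: contraNneq => ->. Qed.

(** Constant words are palindromes, so a pair with an asymmetric member is trivial only through an
    empty word. *)
Lemma trivw_asym_l b c : ~~ palin b -> trivw b c -> c = [::].
Proof.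
move=> b_asym; case/or4P => [/eqP b0|/eqP//|/andP[/palin_const]|/andP[/palin_const]].
- by rewrite b0 in b_asym.
- by rewrite (negPf b_asym).
- by rewrite (negPf b_asym).
Qed.

Lemma trivw_asym_r b c : ~~ palin c -> trivw b c -> b = [::].
Proof.
move=> c_asym; case/or4P => [/eqP//|/eqP c0|/andP[_ /palin_const]|/andP[_ /palin_const]].
- by rewrite c0 in c_asym.
- by rewrite (negPf c_asym).
- by rewrite (negPf c_asym).
Qed.

Lemma trivw_rev b c : trivw (rev b) (rev c) = trivw b c.
Proof.
have rev0 w : (rev w == [::]) = (w == [::] :> bitseq).
  by rewrite -!size_eq0 size_rev.
by rewrite /trivw !rev0 !all_rev.
Qed.

Lemma primw_rev w : primw w -> primw (rev w).
Proof.
move=> Pw b c /(congr1 rev); rewrite revK rev_interleave => /Pw.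
by rewrite trivw_rev.
Qed.

Lemma primw_const x w : all (pred1 x) w -> primw w.
Proof.
move=> wx b c wE; move: wx; rewrite wE all_interleave /trivw.
by case: x => ->; rewrite ?orbT.
Qed.

Lemma primw_asym b c : ~~ palin (b ## c) -> primw (b ## c) ->
  b = [::] \/ c = [::].
Proof.
move=> + /(_ b c erefl); rewrite palin_interleave => bc.
case/or4P => [/eqP|/eqP|/andP[/palin_const b0 /palin_const c0]|].
- by left.
- by right.
- by rewrite b0 c0 in bc.
- by case/andP=> /palin_const b0 /palin_const c0; rewrite b0 c0 in bc.
Qed.

(** * Minimal asymmetric right factors *)

Lemma minasym_factor w : ~~ palin w ->
  exists u v, w = u ## v /\ minasym v.
Proof.
have [n] := ubnP (size w); elim: n w => // n IH w wn w_asym.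
have [wmin|] := pselect (minasym w); first by exists [::], w.
move=> /not_andP[//|/existsNP[u /existsNP[v /not_implyP[wE /not_implyP[u0 /negP v_asym]]]]].
have [||u' [v' [vE v'min]]] := IH v => //.
  by have := size_right_factor v u0; rewrite -wE; lia.
by exists (u ## u'), v'; rewrite interleaveA -vE.
Qed.

(** If the sizes are comparable, one right factor is a right factor of the other and minimality
    forces equality. Otherwise [v = e ## B] with [e] constant and [B] a proper right factor, so [v]
    would be a palindrome. *)
Lemma minasym_uniq u v u' v' : minasym v -> minasym v' ->
  u ## v = u' ## v' -> u = u' /\ v = v'.
Proof.
have comparable a b a' b' : minasym b -> minasym b' -> a ## b = a' ## b' ->
    (size b).+1 %| (size b').+1 -> a = a' /\ b = b'.
  move=> [b_asym _] [_ b'min] E dv.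
  have [d b'E _] := interleave_dvd_factor E dv.
  have d0 : d = [::].
    by apply/eqP; apply: contraNT b_asym => d0; apply: b'min b'E d0.
  by apply: interleave_inj E; rewrite b'E d0.
move=> mv mv' E.
have [dv|dv] := boolP ((size v).+1 %| (size v').+1); first exact: comparable.
have [dv'|dv'] := boolP ((size v').+1 %| (size v).+1).
  by have [] := comparable _ _ _ _ mv' mv (esym E) dv'.
have [x [B [d [e [d' [e' [vE v'E [ex e'x dx d'x] _ _]]]]]]] :=
  interleave_incomparable E dv dv'.
case: mv => [+ vmin]; rewrite vE palin_interleave (palin_const ex) /=.
suff -> : palin B by [].
(* An empty [e] would give [v = B], making the sizes comparable. *)
apply: (vmin e B vE); apply: contra dv => /eqP e0.
by rewrite vE v'E e0 /= size_interleave dvdn_mull.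
Qed.

(** A proper right factor [v] is compared with [s]. If it divides [s], it is symmetric; if [s]
    divides it, irreducibility of [a] gives [v = s]; otherwise [v] is a constant word over a right
    factor of [s]. *)
Lemma minasym_prim a s : primw a -> ~~ palin a -> palin s -> minasym (a ## s).
Proof.
move=> Pa a_asym s_sym; split; first by rewrite palin_interleave negb_and a_asym.
move=> u v E u0.
have [dv|dv] := boolP ((size v).+1 %| (size s).+1).
  have [d sE _] := interleave_dvd_factor (esym E) dv.
  by move: s_sym; rewrite sE palin_interleave => /andP[].
have [ds|ds] := boolP ((size s).+1 %| (size v).+1).
  have [d vE aE] := interleave_dvd_factor E ds.
  rewrite aE in Pa a_asym; have [u0'|d0] := primw_asym a_asym Pa.
    by rewrite u0' in u0.
  by rewrite vE d0.
have [x [B [d [e [d' [e' [sE vE [ex e'x dx d'x] _ _]]]]]]] :=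
  interleave_incomparable E ds dv.
rewrite vE palin_interleave (palin_const e'x) /=.
by move: s_sym; rewrite sE palin_interleave => /andP[].
Qed.

(** For comparable sizes one head is a left factor of the other, and irreducibility makes them
    equal. For incomparable sizes [a = A ## d] with [d] constant and nonempty; irreducibility leaves
    [a = d], a palindrome. *)
Lemma prim_head_uniq a s a' s' :
  primw a -> ~~ palin a -> primw a' -> ~~ palin a' ->
  a ## s = a' ## s' -> a = a'.
Proof.
have comparable b t b' t' : primw b -> ~~ palin b -> ~~ palin b' ->
    b ## t = b' ## t' -> (size t).+1 %| (size t').+1 -> b = b'.
  move=> Pb b_asym b'_asym E dt.
  have [d t'E bE] := interleave_dvd_factor E dt.
  rewrite bE in Pb b_asym; have [b'0|d0] := primw_asym b_asym Pb.
    by rewrite b'0 in b'_asym.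
  by rewrite bE d0 interleave_nil.
move=> Pa a_asym Pa' a'_asym E.
have [ds|ds] := boolP ((size s).+1 %| (size s').+1); first exact: comparable E ds.
have [ds'|ds'] := boolP ((size s').+1 %| (size s).+1).
  by apply/esym; apply: comparable (esym E) ds'.
have [x [B [d [e [d' [e' [sE s'E [ex e'x dx d'x] d0 [A aE _]]]]]]]] :=
  interleave_incomparable E ds ds'.
rewrite aE in Pa a_asym; have [A0|d0'] := primw_asym a_asym Pa.
  by move: a_asym; rewrite A0 /= (palin_const dx).
by rewrite d0' in d0.
Qed.

(** * Existence of irreducible factorisations *)

Lemma left_prim w : w != [::] ->
  exists b c, [/\ w = b ## c, primw b & b != [::]].
Proof.
have [n] := ubnP (size w); elim: n w => // n IH w wn w0.
have [wP|] := pselect (primw w); first by exists w, [::]; rewrite interleave_nil.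
move=> /existsNP[b /existsNP[c /not_implyP[wE /negP]]].
rewrite /trivw !negb_or => /and4P[b0 c0 _ _].
have [||b' [c' [bE b'P b'0]]] := IH b => //.
  by apply: leq_trans (size_left_factor b c0) _; rewrite -wE.
by exists b', (c' ## c); rewrite -interleaveA -bE.
Qed.

Lemma factorisation_nil : factorisation [:: [::]] [::].
Proof.
split=> // b; rewrite inE => /eqP-> u v /esym/eqP.
by rewrite interleave_eq0 /trivw => /andP[->].
Qed.

Lemma factorisation_cons b fs w : factorisation fs w -> w != [::] ->
  primw b -> b != [::] -> ~~ trivw b (head [::] fs) ->
  factorisation (b :: fs) (b ## w).
Proof.
case: fs => [|f fs] [// _ wE srt Pfs] w0 Pb b0 bf; split=> //.
- by rewrite wE.
- by rewrite /= bf.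
- by move=> c; rewrite inE => /orP[/eqP-> //|/Pfs].
Qed.

Lemma factorisation_head_neq0 fs w : factorisation fs w -> w != [::] ->
  head [::] fs != [::].
Proof.
case: fs => [|f [|f' fs]] [//= _ wE srt Pfs] w0.
  by move: w0; rewrite wE /= interleave_nil.
by move: srt => /andP[]; rewrite /trivw !negb_or => /and4P[].
Qed.

Lemma factorisation_last_neq0 fs w : factorisation fs w -> w != [::] ->
  last [::] fs != [::].
Proof.
case/lastP: fs => [|fs f] [//= _ wE srt Pfs] w0; rewrite last_rcons.
move: srt wE; case/lastP: fs Pfs => [|fs f'] Pfs.
  by rewrite /prodw /= interleave_nil => _ <-.
rewrite -!cats1 -catA => /cat_sorted2[_] /=; rewrite andbT.
by rewrite /trivw !negb_or => /and4P[].
Qed.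

(** The first factor is chosen prime with a cofactor of minimal size; a trivial
    pair formed with the next factor could be merged, against minimality. *)
Lemma factorisation_exists w : exists fs, factorisation fs w.
Proof.
have [n] := ubnP (size w); elim: n w => // n IH w wn.
have [->|w0] := eqVneq w [::]; first by exists [:: [::]]; apply: factorisation_nil.
pose P k := `[< exists b c, [/\ w = b ## c, primw b, b != [::] & size c = k] >].
have exP : exists k, P k.
  have [b [c [wE Pb b0]]] := left_prim w0.
  by exists (size c); apply/asboolP; exists b, c.
case: (ex_minnP exP) => k /asboolP[b [c [wE Pb b0 ck]]] kmin.
have [c0|c0] := eqVneq c [::].
  exists [:: w]; split=> //=; first by rewrite interleave_nil.
  by move=> f; rewrite inE wE c0 interleave_nil => /eqP->.
have [|fs fsP] := IH c.
  by have := size_right_factor c b0; rewrite -wE; lia.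
have [bf|bf] := boolP (trivw b (head [::] fs)); last first.
  by exists (b :: fs); rewrite wE; apply: factorisation_cons.
have f0 := factorisation_head_neq0 fsP c0.
case: fs fsP bf f0 => [|f fs] [// _ cE srt Pfs] /= bf f0.
(* Two nonempty words forming a trivial pair are constant with the same letter, so their product is
   constant and hence irreducible. *)
have bfP : primw (b ## f).
  move: bf; rewrite /trivw (negPf b0) (negPf f0) /=.
  by case/orP => bf; [apply: (@primw_const false)|apply: (@primw_const true)];
    rewrite all_interleave.
have /kmin : P (size (prodw fs)).
  apply/asboolP; exists (b ## f), (prodw fs); split=> //.
    by rewrite wE cE interleaveA.
  by rewrite interleave_eq0 negb_and b0.
by have := size_right_factor (prodw fs) f0; rewrite -ck cE /=; lia.
Qed.

Lemma factorisation_minasym fs w : factorisation fs w -> minasym w ->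
  ~~ palin (head [::] fs) && all palin (behead fs).
Proof.
move=> fsP [w_asym wmin].
have f0 := factorisation_head_neq0 fsP (asym_neq0 w_asym).
case: fs fsP f0 => [|f fs] [// _ wE srt Pfs] /= f0.
have fs_sym : palin (prodw fs) by apply: wmin wE f0.
rewrite -palin_prodw fs_sym andbT.
by move: w_asym; rewrite wE /= palin_interleave fs_sym andbT.
Qed.

Lemma minasym_factorisation fs w : factorisation fs w ->
  ~~ palin (head [::] fs) && all palin (behead fs) -> minasym w.
Proof.
case: fs => [|f fs] [// _ wE srt Pfs] /= /andP[f_asym fs_sym].
rewrite wE /=; apply: minasym_prim => //; last by rewrite palin_prodw.
by apply: Pfs; rewrite mem_head.
Qed.

Lemma split_last_notin (T : eqType) (P : pred T) (s : seq T) : ~~ all P s ->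
  exists s1 x s2, [/\ s = s1 ++ x :: s2, ~~ P x & all P s2].
Proof.
elim: s => //= y s IH; have [sP|] := boolP (all P s).
  by rewrite andbT; exists [::], y, s.
by move=> /IH[s1 [x [s2 [-> xP s2P]]]] _; exists (y :: s1), x, s2.
Qed.

(** * Words and compositions *)

(** A letter [true] separates two components, a letter [false] enlarges the first component of what
    follows. The default 0 of [head] is never reached, as the result is nonempty. *)
Fixpoint wcomp (w : bitseq) : seq nat :=
  if w is x :: w' then
    if x then 1 :: wcomp w' else (head 0 (wcomp w')).+1 :: behead (wcomp w')
  else [:: 1].

Lemma comp_cons w : exists h t, wcomp w = h.+1 :: t.
Proof.
by elim: w => [|[] w [h [t E]]] /=; [exists 0, [::]|exists 0, (wcomp w)|exists h.+1, t; rewrite E].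
Qed.

Lemma is_composition_comp w : is_composition (wcomp w).
Proof.
elim: w => [|[] w] //; rewrite /is_composition /=;
  by have [h [t ->]] := comp_cons w; case/andP.
Qed.

Lemma sumn_comp w : sumn (wcomp w) = (size w).+1.
Proof.
by elim: w => [|[] w] //=; have [h [t ->]] := comp_cons w => /=; lia.
Qed.

Lemma size_comp w : size (wcomp w) = (count id w).+1.
Proof.
by elim: w => [|[] w] //=; have [h [t ->]] := comp_cons w => /=; lia.
Qed.

Lemma comp_inj : injective wcomp.
Proof.
elim=> [|x w IH] [|x' w'] //=.
- by have [h [t ->]] := comp_cons w'; case: x'.
- by have [h [t ->]] := comp_cons w; case: x.
case: x x' => [] [] //.
- by case=> /IH->.
- by have [h [t ->]] := comp_cons w'.
- by have [h [t ->]] := comp_cons w.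
- move=> E; congr cons; apply: IH; move: E.
  by have [h [t ->]] := comp_cons w; have [h' [t' ->]] := comp_cons w' => /= -[-> ->].
Qed.

Lemma comp_surj s : is_composition s -> exists w, s = wcomp w.
Proof.
have [n] := ubnP (sumn s); elim: n s => // n IH [|[|[|h]] [|a s]] //=.
- by exists [::].
- rewrite /is_composition /= => sn /andP[a0 s1].
  have [||w E] := IH (a :: s); [exact: sn|by rewrite /is_composition /= a0|].
  by exists (true :: w); rewrite /= E.
- rewrite /is_composition /= => sn _.
  have [||w E] := IH [:: h.+1]; [exact: sn|by []|].
  by exists (false :: w); rewrite /= -E.
- rewrite /is_composition /= => sn sP.
  have [||w E] := IH [:: h.+1, a & s]; [exact: sn|by []|].
  by exists (false :: w); rewrite /= -E.
Qed.

Lemma comp_catT v w : wcomp (v ++ true :: w) = wcomp v ++ wcomp w.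
Proof.
by elim: v => [|[] v IH] //=; rewrite IH //; have [h [t ->]] := comp_cons v.
Qed.

Lemma near_cat_cons a s t : s != [::] -> near_cat (a :: s) t = a :: near_cat s t.
Proof. by case: s. Qed.

Lemma comp_catF v w : wcomp (v ++ false :: w) = near_cat (wcomp v) (wcomp w).
Proof.
elim: v => [|[] v IH] //=.
  by rewrite near_cat_cons -?IH //; have [h [t ->]] := comp_cons v.
rewrite IH; have [h [[|a t] ->]] := comp_cons v => //.
Qed.

Lemma near_cat_catr a b c : b != [::] -> near_cat a (b ++ c) = near_cat a b ++ c.
Proof. by case: b => // x b _; rewrite /near_cat /= -catA. Qed.

(** Each letter of [u] joins two copies of [v]: [true] by concatenation, [false] by near
    concatenation, exactly as [circ] assembles its blocks. *)
Lemma circ_comp u v : circ (wcomp u) (wcomp v) = wcomp (u ## v).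
Proof.
elim: u => [|[] u IH]; first by rewrite /circ /= cats0.
  by rewrite /= comp_catT -IH.
rewrite /= comp_catF -IH; have [h [t ->]] := comp_cons u.
rewrite /circ /= near_cat_catr //.
have [h' [t' E]] := comp_cons v; rewrite /near_pow /=.
case: h => [|h] /=; first by rewrite E.
by rewrite /near_cat -size_eq0 size_cat /= addnS.
Qed.

Lemma rev_comp w : rev (wcomp w) = wcomp (rev w).
Proof.
elim: w => [|[] w IH] //; rewrite rev_cons -cats1.
  by rewrite comp_catT -IH /= rev_cons cats1.
rewrite comp_catF -IH /=; have [h [t ->]] := comp_cons w => /=.
rewrite !rev_cons /near_cat size_rcons /= last_rcons -!cats1 addn1.
by rewrite take_size_cat.
Qed.

Lemma all_comp_ones w : all (pred1 1) (wcomp w) = all (pred1 true) w.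
Proof.
elim: w => [|[] w IH] //=.
by have [h [t ->]] := comp_cons w.
Qed.

Lemma size_comp_eq1 w : (size (wcomp w) == 1) = all (pred1 false) w.
Proof.
by rewrite size_comp eqSS; elim: w => [|[] w IH] //=.
Qed.

Lemma trivial_pair_comp b c : trivial_pair (wcomp b) (wcomp c) = trivw b c.
Proof.
have eq1 w : (wcomp w == [:: 1]) = (w == [::]) by rewrite (inj_eq comp_inj _ [::]).
by rewrite /trivial_pair !eq1 !size_comp_eq1 !all_comp_ones.
Qed.

Lemma only_trivial_comp w : only_trivial_factorisations (wcomp w) <-> primw w.
Proof.
split=> [H b c wE|H b c /comp_surj[u ->] /comp_surj[v ->]].
  rewrite -trivial_pair_comp; apply: H; rewrite ?is_composition_comp //.
  by rewrite circ_comp wE.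
by rewrite circ_comp => /comp_inj/H; rewrite trivial_pair_comp.
Qed.

Lemma comp_surj_seq fs : all is_composition fs -> exists ws, fs = map wcomp ws.
Proof.
elim: fs => [|f fs IH] /=; first by exists [::].
by move=> /andP[/comp_surj[w ->] /IH[ws ->]]; exists (w :: ws).
Qed.

Lemma foldr_circ_comp ws : foldr circ [:: 1] (map wcomp ws) = wcomp (prodw ws).
Proof. by elim: ws => //= w ws ->; rewrite circ_comp. Qed.

Lemma irreducible_factorisation_comp ws w :
  irreducible_factorisation (map wcomp ws) (wcomp w) <-> factorisation ws w.
Proof.
have srtE : sorted (fun b c => ~~ trivial_pair b c) (map wcomp ws) =
    sorted (fun b c => ~~ trivw b c) ws.
  by rewrite sorted_map; apply: eq_sorted => b c /=; rewrite trivial_pair_comp.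
split=> -[].
  rewrite srtE foldr_circ_comp => ws0 _ /comp_inj wE srt H; split=> //.
    by move: ws0; case: (ws).
  by move=> b bw; apply/only_trivial_comp/H/map_f.
move=> ws0 wE srt H; split.
- by move: ws0; case: (ws).
- by rewrite all_map; apply/allP => b _ /=; apply: is_composition_comp.
- by rewrite foldr_circ_comp wE.
- by rewrite srtE.
- by move=> _ /mapP[b bw ->]; apply/only_trivial_comp/H.
Qed.

Lemma symmetric_comp_comp w : symmetric_comp (wcomp w) = palin w.
Proof. by rewrite /symmetric_comp rev_comp (inj_eq comp_inj). Qed.

(** * Normalised words and reversal *)

Definition lexmin (w : bitseq) : bool := lex_minimal (wcomp w).

Lemma lexmin_palin w : palin w -> lexmin w.
Proof. by move=> /eqP E; rewrite /lexmin /lex_minimal rev_comp -E Order.POrderTheory.lexx. Qed.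

Lemma lexmin_total w : lexmin w || lexmin (rev w).
Proof.
by rewrite /lexmin /lex_minimal !rev_comp revK Order.TotalTheory.le_total.
Qed.

Lemma lexmin_anti w : lexmin w -> lexmin (rev w) -> palin w.
Proof.
rewrite /lexmin /lex_minimal !rev_comp revK => h1 h2.
by apply/eqP/comp_inj; apply: (Order.POrderTheory.le_anti (introT andP (conj h1 h2))).
Qed.

Definition normw (w : bitseq) : Prop :=
  exists2 fs, factorisation fs w & all lexmin fs.

Lemma normalised_comp w : normalised (wcomp w) <-> normw w.
Proof.
split=> [[fs fsP]|[fs fsP lfs]].
  have [ws E] : exists ws, fs = map wcomp ws by case: fsP => _ /comp_surj_seq.
  move: fsP; rewrite E => /irreducible_factorisation_comp fsP; rewrite all_map => lfs.
  by exists ws.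
exists (map wcomp fs); first exact/irreducible_factorisation_comp.
by rewrite all_map.
Qed.

Lemma asymmetric_then_symmetric_comp w :
  asymmetric_then_symmetric (wcomp w) <-> minasym w.
Proof.
have headE ws : symmetric_comp (head [::] (map wcomp ws)) = palin (head [::] ws).
  by case: ws => //= a l; rewrite symmetric_comp_comp.
have tailE ws : all symmetric_comp (behead (map wcomp ws)) = all palin (behead ws).
  case: ws => //= _ l; rewrite all_map.
  by apply: eq_all => a /=; rewrite symmetric_comp_comp.
split=> [[fs fsP]|wmin].
  have [ws E] : exists ws, fs = map wcomp ws by case: fsP => _ /comp_surj_seq.
  move: fsP; rewrite E headE tailE => /irreducible_factorisation_comp fsP.
  exact: minasym_factorisation.
have [fs fsP] := factorisation_exists w.
exists (map wcomp fs); first exact/irreducible_factorisation_comp.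
by rewrite headE tailE (factorisation_minasym fsP).
Qed.

(** All factors of a symmetric word are symmetric, hence lexicographic minimal. These words give the
    term $S_n$ of the recurrence for $R_n$. *)
Lemma normw_palin w : palin w -> normw w.
Proof.
have [fs fsP] := factorisation_exists w => w_sym; exists fs => //.
move: w_sym; case: fsP => _ -> _ _; rewrite palin_prodw.
by apply: sub_all; apply: lexmin_palin.
Qed.

(** The two factorisations can be concatenated: at the junction a nonempty factor meets an
    asymmetric one, and such a pair is not trivial. *)
Lemma normw_interleave u v : minasym v -> normw u -> normw v -> normw (u ## v).
Proof.
move=> vmin; have [->//|u0] := eqVneq u [::].
move=> [fs fsP lfs] [gs gsP lgs].
exists (fs ++ gs); last by rewrite all_cat lfs.
have f0 := factorisation_last_neq0 fsP u0.
have /andP[g_asym _] := factorisation_minasym gsP vmin.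
case: fs gs {lfs lgs} fsP gsP f0 g_asym => [|f fs] [|g gs] [// _ uE srt Pf] [// _ vE srt' Pg] f0 g_asym.
split=> //; first by rewrite prodw_cat uE vE.
  rewrite /= cat_path /=; move: srt srt' => /= -> ->; rewrite andbT /=.
  by apply: contra f0 => /(trivw_asym_r g_asym)/eqP.
by move=> b; rewrite mem_cat => /orP[/Pf|/Pg].
Qed.

(** The factorisation is cut just before its last asymmetric factor; what follows that factor is
    symmetric. *)
Lemma normw_minasym_factor w : normw w -> ~~ palin w ->
  exists u v, [/\ w = u ## v, normw u, normw v & minasym v].
Proof.
move=> [fs [_ wE srt Pfs] lfs]; rewrite wE palin_prodw => /split_last_notin.
move=> [fs1 [a [fs2 [fsE a_asym fs2_sym]]]].
move: srt lfs Pfs; rewrite fsE => /cat_sorted2[srt1 srt2].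
rewrite all_cat => /andP[l1 l2] Pfs.
have fP2 : factorisation (a :: fs2) (prodw (a :: fs2)).
  by split=> // b bfs; apply: Pfs; rewrite mem_cat bfs orbT.
exists (prodw fs1), (prodw (a :: fs2)); split; first by rewrite prodw_cat.
- have [->|fs10] := eqVneq fs1 [::]; first exact: normw_palin.
  exists fs1 => //; split=> // b bfs; apply: Pfs; by rewrite mem_cat bfs.
- by exists (a :: fs2).
- by apply: minasym_factorisation fP2 _; rewrite a_asym.
Qed.

Lemma minasym_rev w : minasym w -> minasym (rev w).
Proof.
move=> [w_asym wmin]; split=> [|u v]; first by rewrite palin_rev.
move=> /(congr1 rev); rewrite revK rev_interleave => /wmin.
by rewrite palin_rev -!size_eq0 size_rev.
Qed.

(** All factors but the first are symmetric, so reversal only reverses the first one, [f]; as [f] is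
    asymmetric, exactly one of [f] and [rev f] is lexicographic minimal. *)
Lemma normw_rev w : minasym w -> normw (rev w) <-> ~ normw w.
Proof.
move=> wmin; split.
  move=> [gs gsP lgs] [fs fsP lfs].
  have := factorisation_minasym fsP wmin.
  have := factorisation_minasym gsP (minasym_rev wmin).
  case: fs gs fsP gsP lfs lgs => [|f fs] [|g gs] [// _ wE _ Pf] [// _ rE _ Pg].
  move=> /andP[lf _] /andP[lg _] /andP[g_asym _] /andP[f_asym _].
  have fP : primw f by apply: Pf; rewrite mem_head.
  have gP : primw (rev g) by apply/primw_rev/Pg; rewrite mem_head.
  (* Reversing the factorisation of [rev w] gives a second splitting of [w] with an irreducible
     asymmetric head. *)
  have fE : f = rev g.
    apply: (@prim_head_uniq f (prodw fs) (rev g) (rev (prodw gs))) => //.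
      by rewrite palin_rev.
    by rewrite -rev_interleave -[g ## _]/(prodw (g :: gs)) -rE revK wE.
  by move: g_asym; rewrite /= (lexmin_anti lg) // -fE.
move=> wN; have [fs fsP] := factorisation_exists w.
have := factorisation_minasym fsP wmin.
case: fs fsP => [|f fs] fsP; case: (fsP) => // _ wE srt Pf /= /andP[f_asym fs_sym].
have lfs : all lexmin fs by apply: sub_all fs_sym; apply: lexmin_palin.
have lf : lexmin (rev f).
  have := lexmin_total f; have [lf|//] := boolP (lexmin f).
  by case: wN; exists (f :: fs) => //=; rewrite lf.
exists (rev f :: fs); last by rewrite /= lf.
split=> //.
- rewrite wE /= rev_interleave; congr interleave.
  by apply/esym/eqP; change (palin (prodw fs)); rewrite palin_prodw.
- case: fs srt {fsP wE Pf fs_sym lfs} => //= g gs /andP[fg ->]; rewrite andbT.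
  apply: contra fg => /trivw_asym_l; rewrite palin_rev => /(_ f_asym) ->.
  by rewrite /trivw eqxx orbT.
- move=> b; rewrite inE => /orP[/eqP->|bfs].
    by apply/primw_rev/Pf; rewrite mem_head.
  by apply: Pf; rewrite inE bfs orbT.
Qed.

(** * Generating functions *)

Fixpoint words (k : nat) : seq bitseq :=
  if k is k'.+1 then map (cons true) (words k') ++ map (cons false) (words k')
  else [:: [::]].

Lemma mem_words k w : (w \in words k) = (size w == k).
Proof.
elim: k w => [|k IH] w /=; first by rewrite inE size_eq0.
rewrite mem_cat; case: w => [|x w].
  by apply/norP; split; apply/negP => /mapP[].
have memE y : (x :: w \in map (cons y) (words k)) = (x == y) && (w \in words k).
  apply/mapP/andP => [[v vk [-> ->]]//|[/eqP-> wk]]; by exists w.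
by rewrite !memE IH /= eqSS; case: (x); rewrite /= ?orbF.
Qed.

Lemma words_uniq k : uniq (words k).
Proof.
elim: k => //= k IH; rewrite cat_uniq !map_inj_uniq ?IH ?andbT /=;
  try by move=> ? ? [].
by apply/hasPn => _ /mapP[v _ ->]; apply/negP => /mapP[].
Qed.

Lemma sum_words_rev (V : nmodType) k (P : pred bitseq) (G : bitseq -> V) :
  (\sum_(w <- words k | P (rev w)) G (rev w) = \sum_(w <- words k | P w) G w)%R.
Proof.
rewrite -(big_map rev P G); apply: perm_big; apply: uniq_perm.
- by rewrite map_inj_uniq ?words_uniq //; apply: can_inj revK.
- exact: words_uniq.
- move=> w; rewrite mem_words; apply/mapP/eqP => [[v]|wk].
    by rewrite mem_words => /eqP <- ->; rewrite size_rev.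
  by exists (rev w); rewrite ?revK // mem_words size_rev wk.
Qed.

(** Reindexes along [(u, v) |-> u ## v]; uniqueness of the minimal asymmetric
    right factor makes it injective across all sizes of [v]. *)
Lemma sum_words_factor (V : nmodType) n (P Q T : pred bitseq) (G : bitseq -> V) :
    0 < n -> (forall v, T v -> minasym v) ->
    (forall w, P w <-> exists u v, [/\ w = u ## v, Q u & T v]) ->
  (\sum_(w <- words n.-1 | P w) G w =
   \sum_(d <- divisors n) \sum_(u <- words d.-1 | Q u)
     \sum_(v <- words (n %/ d).-1 | T v) G (u ## v))%R.
Proof.
move=> n0 Tmin PE.
pose L d := [seq u ## v | u <- filter Q (words d.-1),
                          v <- filter T (words (n %/ d).-1)].
have memL d w : 0 < d -> d %| n -> w \in L d ->
    exists u v, [/\ w = u ## v, Q u, T v & (size u).+1 = d /\ (size v).+1 = n %/ d].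
  move=> d0 dn; have q0 : 0 < n %/ d by rewrite divn_gt0 // dvdn_leq.
  move=> /allpairsPdep[u [v [uL vL ->]]]; move: uL vL; rewrite !mem_filter !mem_words.
  move=> /andP[Qu /eqP su] /andP[Tv /eqP sv]; exists u, v.
  by rewrite su sv !prednK.
transitivity (\sum_(w <- [seq w | d <- divisors n, w <- L d]) G w)%R; last first.
  rewrite big_allpairs_dep; apply: eq_bigr => d _.
  rewrite big_allpairs_dep big_filter; apply: eq_bigr => u _.
  by rewrite big_filter.
rewrite -big_filter; apply: perm_big; apply: uniq_perm.
- by rewrite filter_uniq ?words_uniq.
- apply: allpairs_uniq_dep; first exact: divisors_uniq.
    move=> d; rewrite -dvdn_divisors // => dn.
    apply: allpairs_uniq_dep; rewrite ?filter_uniq ?words_uniq //.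
    move=> x y /allpairsPdep[u [v [_ + xE]]] /allpairsPdep[u' [v' [_ + yE]]].
    rewrite xE yE !mem_filter /= => /andP[/Tmin vm _] /andP[/Tmin v'm _].
    by move=> /(minasym_uniq vm v'm)[-> ->].
  move=> x y /allpairsPdep[d [w [+ wL xE]]] /allpairsPdep[d' [w' [+ wL' yE]]].
  rewrite xE yE -!dvdn_divisors //= => dn dn' E.
  have [u [v [wE _ /Tmin vm [<- _]]]] := memL d w (dvdn_gt0 n0 dn) dn wL.
  have [u' [v' [wE' _ /Tmin v'm [<- _]]]] := memL d' w' (dvdn_gt0 n0 dn') dn' wL'.
  by move: E; rewrite wE wE' => /(minasym_uniq vm v'm)[-> ->].
- move=> w; rewrite mem_filter mem_words; apply/idP/idP.
    case/andP => /PE[u [v [-> Qu Tv]]] /eqP sw.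
    have nE : n = (size u).+1 * (size v).+1.
      by rewrite -size_interleave sw prednK.
    apply/allpairsPdep; exists (size u).+1, (u ## v); split=> //.
      by rewrite -dvdn_divisors // nE dvdn_mulr.
    apply/allpairsPdep; exists u, v; rewrite !mem_filter !mem_words Qu Tv /=.
    by rewrite nE mulKn // !eqxx.
  move=> /allpairsPdep[d [w' [+ w'L ->]]]; rewrite -dvdn_divisors // => dn.
  have d0 : 0 < d by apply: dvdn_gt0 dn.
  have [u [v [-> Qu Tv [su sv]]]] := memL d w' d0 dn w'L.
  have -> : P (u ## v) by apply/PE; exists u, v.
  by rewrite /= -eqSS size_interleave su sv mulnC divnK // prednK.
Qed.

Local Open Scope ring_scope.

Definition words_gf (P : pred bitseq) (n : nat) : {poly rat} :=
  \sum_(w <- words n.-1 | P w) 'X^((count id w).+1).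

Lemma length_gfE n (A : set (seq nat)) : (0 < n)%N ->
    (forall s, A s -> is_composition_of n s) ->
  length_gf A = words_gf (fun w => `[< A (wcomp w) >]) n.
Proof.
move=> n0 An; rewrite /words_gf /length_gf.
pose r := [seq wcomp w | w <- words n.-1 & `[< A (wcomp w) >]].
have AE : A = [set` r]%classic.
  apply/seteqP; split=> s /=.
    move=> As; have /andP[/comp_surj[w sE] /eqP sn] := An _ As.
    apply/mapP; exists w => //; rewrite mem_filter mem_words -sE.
    apply/andP; split; first exact/asboolP.
    by rewrite -eqSS -sumn_comp -sE sn prednK.
  by move=> /mapP[w]; rewrite mem_filter => /andP[/asboolP Aw _] ->.
rewrite [in LHS]AE -fsbig_seq.
  by rewrite big_map big_filter; apply: eq_bigr => w _; rewrite size_comp.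
by rewrite map_inj_uniq ?filter_uniq ?words_uniq //; apply: comp_inj.
Qed.

Lemma Xpow_neq0 m : Xpow m != 0.
Proof. by rewrite /Xpow tofrac_eq0 expf_neq0 ?polyX_eq0. Qed.

Lemma XpowD m k : Xpow (m + k) = Xpow m * Xpow k.
Proof. by rewrite /Xpow exprD tofracM. Qed.

Lemma at_Xn1 p : at_Xn p 1 = tofrac p.
Proof. by rewrite /at_Xn expr1 comp_polyXr. Qed.

Lemma at_XnZ c p e : at_Xn (c *: p) e = tofrac c%:P * at_Xn p e.
Proof. by rewrite /at_Xn comp_polyZ -mul_polyC tofracM. Qed.

Lemma at_words_gf P n e :
  at_Xn (words_gf P n) e =
  \sum_(w <- words n.-1 | P w) Xpow (e * (count id w).+1).
Proof.
rewrite /at_Xn /words_gf !raddf_sum /=; apply: eq_bigr => w _.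
by rewrite rmorphXn /= comp_polyX -exprM.
Qed.

(** With [d = (size u).+1] and [a], [b] the numbers of [true] in [u], [v], the exponent of [u ## v]
    is [e * (a + d * b + 1)], which is [e * (a + 1) + e * d * (b + 1) - e * d]; this explains the
    denominator. *)
Lemma at_words_gf_factor n e (P Q T : pred bitseq) :
    (0 < n)%N -> (forall v, T v -> minasym v) ->
    (forall w, P w <-> exists u v, [/\ w = u ## v, Q u & T v]) ->
  at_Xn (words_gf P n) e = \sum_(d <- divisors n)
    at_Xn (words_gf Q d) e * at_Xn (words_gf T (n %/ d)) (e * d) / Xpow (e * d).
Proof.
move=> n0 Tmin PE; rewrite at_words_gf (sum_words_factor _ n0 Tmin PE).
rewrite !big_seq; apply: eq_bigr => d; rewrite -dvdn_divisors // => dn.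
have d0 : (0 < d)%N by apply: dvdn_gt0 dn.
rewrite !at_words_gf !mulr_suml big_seq_cond [RHS]big_seq_cond.
apply: eq_bigr => u; rewrite mem_words => /andP[/eqP su _].
rewrite mulr_sumr mulr_suml; apply: eq_bigr => v _.
apply: (mulIf (Xpow_neq0 (e * d))); rewrite divfK ?Xpow_neq0 // -!XpowD.
by congr Xpow; rewrite count_interleave su prednK //; nia.
Qed.

Lemma Cpoly_words n : Cpoly n = words_gf predT n.
Proof.
rewrite /Cpoly /words_gf subn1; elim: n.-1 => [|k IH] /=.
  by rewrite big_seq1 expr0 mulr1 expr1.
rewrite big_cat !big_map /= -IH.
under eq_bigr do rewrite add1n exprS.
by rewrite -mulr_sumr -IH exprS mulrCA mulrDl mul1r addrC.
Qed.

(** A palindrome with at least two letters is a shorter palindrome with the same letter added at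
    both ends, which multiplies the generating function by $1+x^2$. *)
Lemma Spoly_words n : (0 < n)%N -> Spoly n = words_gf palin n.
Proof.
rewrite /words_gf; have [m] := ubnP n; elim: m n => // m IH [|[|[|n]]] // nm _.
- by rewrite /= big_cons big_nil /= /Spoly /= expr0 expr1 mulr1 addr0.
- rewrite /= !big_cons big_nil /= /Spoly /= expr0 expr1 mulr1 addr0.
  by rewrite mulrDr mulr1 addrC.
have SE : Spoly n.+3 = (1 + 'X^2) * Spoly n.+1.
  rewrite /Spoly /= negbK; case: ifP => nodd.
    rewrite (_ : ((n.+3 - 1) %/ 2 = ((n.+1 - 1) %/ 2).+1)%N); last by lia.
    by rewrite exprS mulrCA.
  rewrite (_ : ((n.+3 - 2) %/ 2 = ((n.+1 - 2) %/ 2).+1)%N); last first.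
    by case: n nodd {IH nm} => // n _; lia.
  by rewrite exprS mulrCA.
rewrite SE IH //=; last by lia.
transitivity (\sum_(w <- [seq x :: rcons v x | x <- [:: true; false],
    v <- filter palin (words n)]) ('X^((count id w).+1) : {poly rat})).
  rewrite big_allpairs_dep big_cons big_seq1 !big_filter mulrDl mul1r [RHS]addrC.
  congr (_ + _).
    by apply: eq_bigr => v _; rewrite /= -cats1 count_cat /= !addn0 add0n.
  rewrite mulr_sumr; apply: eq_bigr => v _.
  by rewrite -exprD /= -cats1 count_cat /=; congr ('X^_); lia.
rewrite -[RHS]big_filter; apply: perm_big; apply: uniq_perm.
- apply: allpairs_uniq; rewrite ?filter_uniq ?words_uniq //.
  by move=> [x v] [y t] _ _ /= [-> /rcons_inj[->]].
- by rewrite filter_uniq // (words_uniq n.+2).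
move=> w; rewrite mem_filter (mem_words n.+2).
apply/allpairsP/andP => [[[x v] /=]|[w_sym]].
  rewrite mem_filter mem_words => -[_ /andP[v_sym /eqP sv] ->].
  rewrite /= size_rcons sv eqxx; split=> //.
  by rewrite /palin rev_cons rev_rcons rcons_cons eqseq_cons eqseq_rcons !eqxx andbT.
case: w w_sym => // x w; case/lastP: w => // v y + /eqP[].
rewrite /palin rev_cons rev_rcons rcons_cons eqseq_cons eqseq_rcons size_rcons.
move=> /and3P[/eqP <- v_sym _] [sv].
exists (x, v); rewrite mem_filter mem_words /palin v_sym /=; split=> //.
  by case: (x).
by rewrite sv.
Qed.

Lemma R1poly_words n : (0 < n)%N ->
  R1poly n = words_gf (fun w => `[< normw w /\ minasym w >]) n.
Proof.
move=> n0; rewrite /R1poly (length_gfE n0) => [|s []//].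
rewrite /words_gf big_seq_cond [RHS]big_seq_cond; apply: eq_bigl => w.
rewrite mem_words; case: eqVneq => //= sw; apply/asboolP/asboolP.
  by case=> _ /normalised_comp wn /asymmetric_then_symmetric_comp.
move=> [wn wm]; split.
- by rewrite /is_composition_of is_composition_comp sumn_comp sw prednK ?eqxx.
- exact/normalised_comp.
- exact/asymmetric_then_symmetric_comp.
Qed.

Lemma Rpoly_words n : (0 < n)%N -> Rpoly n = words_gf (fun w => `[< normw w >]) n.
Proof.
move=> n0; rewrite /Rpoly (length_gfE n0) => [|s []//].
rewrite /words_gf big_seq_cond [RHS]big_seq_cond; apply: eq_bigl => w.
rewrite mem_words; case: eqVneq => //= sw; apply/asboolP/asboolP.
  by move=> [_ /normalised_comp].
move=> wn; split; last exact/normalised_comp.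
by rewrite /is_composition_of is_composition_comp sumn_comp sw prednK ?eqxx.
Qed.

(** The empty word is a palindrome. This kills the term $d=n$, so that the recurrence for [Rpoly]
    runs over proper divisors. *)
Lemma R1poly1 : R1poly 1 = 0.
Proof.
rewrite R1poly_words // /words_gf /= big_cons big_nil; case: asboolP => //.
by move=> [_ []].
Qed.

(* Reversal exchanges the normalised and the other words counted here. *)
Lemma words_gf_minasym n : (0 < n)%N ->
  words_gf (fun w => `[< minasym w >]) n = 2 *: R1poly n.
Proof.
move=> n0; rewrite R1poly_words // scaler_nat mulr2n /words_gf.
rewrite (bigID (fun w => `[< normw w >])) /=; congr (_ + _).
  by apply: eq_bigl => w; rewrite asbool_and andbC.
rewrite -sum_words_rev; apply: eq_big => [w|w _]; last by rewrite count_rev.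
apply/andP/asboolP => [[/asboolP wm /asboolP wn]|[wn wm]].
  have := minasym_rev wm; rewrite revK => wm'; split=> //.
  by have := normw_rev wm; rewrite revK => E; apply/E.
split; first exact/asboolP/minasym_rev.
by apply/asboolP => wN; case: (normw_rev wm) => /(_ wN).
Qed.

(** Each asymmetric word is uniquely an arbitrary word interleaved with a minimal asymmetric one.
    The latter are counted by [2 *: R1poly], which cancels the factor one half. *)
Lemma at_Lxpoly n e : (0 < n)%N -> at_Xn (Lxpoly n) e =
  \sum_(d <- divisors n)
    at_Xn (Cpoly d) e * at_Xn (R1poly (n %/ d)) (e * d) / Xpow (e * d).
Proof.
move=> n0; have -> : Lxpoly n = 2^-1 *: words_gf (fun w => ~~ palin w) n.
  congr (_ *: _); rewrite Cpoly_words Spoly_words // /words_gf.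
  by apply/eqP; rewrite (bigID palin) /= subr_eq addrC.
rewrite at_XnZ (@at_words_gf_factor _ _ _ predT (fun w => `[< minasym w >])) //.
- rewrite mulr_sumr !big_seq; apply: eq_bigr => d; rewrite -dvdn_divisors // => dn.
  rewrite words_gf_minasym; last by rewrite divn_gt0 ?(dvdn_gt0 n0 dn) // dvdn_leq.
  rewrite at_XnZ -Cpoly_words !mulrA [_ * at_Xn (Cpoly d) e]mulrC -!mulrA.
  congr (_ * _); rewrite mulrA -tofracM -polyCM mulVf // tofrac1 mul1r //.
- by move=> v /asboolP.
- move=> w; split=> [/minasym_factor[u [v [-> vm]]]|[u [v [-> _ /asboolP[v_asym _]]]]].
    by exists u, v; split=> //; apply/asboolP.
  by rewrite palin_interleave negb_and v_asym orbT.
Qed.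

(** Normalised words are either symmetric or split uniquely into a normalised left factor and a
    normalised minimal asymmetric right factor. *)
Lemma Rpoly_rec n : (0 < n)%N -> tofrac (Rpoly n) = tofrac (Spoly n) +
  \sum_(d <- divisors n | d != n)
    tofrac (Rpoly d) * (at_Xn (R1poly (n %/ d)) d / Xpow d).
Proof.
move=> n0; have -> : Rpoly n =
    Spoly n + words_gf (fun w => `[< normw w >] && ~~ palin w) n.
  rewrite Rpoly_words // Spoly_words // /words_gf (bigID palin) /=.
  congr (_ + _); apply: eq_bigl => w.
  apply/andP/idP => [[]//|w_sym]; split=> //.
  exact/asboolP/normw_palin.
rewrite tofracD; congr (_ + _).
rewrite -[LHS]at_Xn1 (@at_words_gf_factor _ _ _ (fun w => `[< normw w >])
  (fun w => `[< normw w /\ minasym w >])) //.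
- rewrite [RHS]big_mkcond !big_seq /=; apply: eq_bigr => d.
  rewrite -dvdn_divisors // => dn; have d0 := dvdn_gt0 n0 dn.
  have nd0 : (0 < n %/ d)%N by rewrite divn_gt0 // dvdn_leq.
  rewrite -Rpoly_words // -R1poly_words // mul1n at_Xn1 -mulrA.
  case: eqVneq => //= ->; rewrite divnn n0 R1poly1 /at_Xn comp_poly0 tofrac0.
  by rewrite mul0r mulr0.
- by move=> v /asboolP[].
- move=> w; split=> [/andP[/asboolP wn w_asym]|].
    have [u [v [-> un vn vm]]] := normw_minasym_factor wn w_asym.
    by exists u, v; split=> //; apply/asboolP.
  move=> [u [v [-> /asboolP un /asboolP[vn vm]]]]; apply/andP; split.
    exact/asboolP/normw_interleave.
  by rewrite palin_interleave negb_and vm.1 orbT.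
Qed.

(** * Chains of divisors *)

(** Here [k] is fuel: the predecessor of [n] in a chain is a smaller divisor, so any [k >= n] lists
    all chains. *)
Fixpoint chains_to_seq (k n : nat) : seq (seq nat) :=
  if k is k'.+1 then
    [:: n] :: [seq rcons c n | d <- [seq d <- divisors n | d != n],
                               c <- chains_to_seq k' d]
  else [::].

Lemma strict_divisor_chain_rcons c x :
  strict_divisor_chain (rcons c x) =
  if c is [::] then (0 < x)%N else
    [&& strict_divisor_chain c, (last 0%N c %| x)%N, last 0%N c != x & (0 < x)%N].
Proof.
case: c => [|a c]; rewrite /strict_divisor_chain /= ?andbT //.
rewrite all_rcons rcons_path /=.
by case: (0 < x)%N; case: (0 < a)%N; case: (all _ c); case: path;
  rewrite /= ?andbF ?andbT.
Qed.

Lemma mem_chains_to_seq k n c : (0 < n <= k)%N ->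
  (c \in chains_to_seq k n) = strict_divisor_chain c && (last 0%N c == n).
Proof.
elim: k n c => [|k IH] n c /andP[n0 nk] /=; first by move: nk; case: n n0.
rewrite inE; have divP d : d \in [seq d <- divisors n | d != n] ->
    [/\ (d %| n)%N, d != n & (0 < d <= k)%N].
  rewrite mem_filter -dvdn_divisors // => /andP[dn dvd]; split=> //.
  rewrite (dvdn_gt0 n0 dvd) -ltnS (leq_trans _ nk) //.
  by rewrite ltn_neqAle dn dvdn_leq.
apply/orP/andP => [[/eqP->|/allpairsPdep[d [c' [dP c'P ->]]]]|[]].
- by rewrite /strict_divisor_chain /= n0 eqxx.
- have [dn dneq dk] := divP _ dP; move: c'P; rewrite IH // last_rcons eqxx.
  rewrite strict_divisor_chain_rcons => /andP[cs /eqP cd].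
  case: c' cs cd => [|a c'] cs cd; first by rewrite n0.
  by rewrite cd dn dneq cs n0.
- case/lastP: c => [|c x]; first by move=> _ /eqP n0'; rewrite -n0' in n0.
  rewrite last_rcons => + /eqP xn; rewrite xn strict_divisor_chain_rcons.
  case: c => [|a c]; first by left.
  move=> /and4P[cs dv dneq _]; right; set d := last _ _ in dv dneq.
  have dP : d \in [seq d <- divisors n | d != n].
    by rewrite mem_filter dneq -dvdn_divisors.
  apply/allpairsPdep; exists d, (a :: c); split=> //.
  by have [_ _ dk] := divP _ dP; rewrite IH // cs eqxx.
Qed.

Lemma chains_to_seq_uniq k n : (0 < n <= k)%N -> uniq (chains_to_seq k n).
Proof.
elim: k n => [|k IH] n //= /andP[n0 nk].
have divP d : d \in [seq d <- divisors n | d != n] -> (0 < d <= k)%N.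
  rewrite mem_filter -dvdn_divisors // => /andP[dn dvd].
  rewrite (dvdn_gt0 n0 dvd) -ltnS (leq_trans _ nk) //.
  by rewrite ltn_neqAle dn dvdn_leq.
apply/andP; split.
  apply/negP => /allpairsPdep[d [c [/divP dP cP /(congr1 size)]]].
  rewrite size_rcons => -[] /esym/size0nil c0; move: cP.
  by rewrite mem_chains_to_seq // c0 /=; case/andP: dP; case: (d).
apply: allpairs_uniq_dep; first by rewrite filter_uniq ?divisors_uniq.
  by move=> d /divP/IH.
move=> x y /allpairsPdep[d [c [/divP dP cP xE]]] /allpairsPdep[d' [c' [/divP dP' cP' yE]]].
rewrite xE yE /= => /rcons_inj[cE]; move: cP cP'; rewrite !mem_chains_to_seq // cE.
by move=> /andP[_ /eqP <-] /andP[_ /eqP <-].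
Qed.

Lemma chains_toE k n : (0 < n <= k)%N -> chains_to n = [set` chains_to_seq k n]%classic.
Proof.
move=> nk; apply/seteqP; split=> c /=.
  by rewrite mem_chains_to_seq // => -[-> ->]; rewrite eqxx.
by rewrite mem_chains_to_seq // => /andP[cs /eqP].
Qed.

(** Common shape of the summands of both formulas: a weight for the start of the chain and one for
    each step. *)
Definition chain_weight (F : fieldType) (U : nat -> F) (W : nat -> nat -> F)
    (c : seq nat) : F :=
  U (head 0%N c) * \prod_(i < (size c).-1) W (nth 0%N c i) (nth 0%N c i.+1).

Definition chain_sum (F : fieldType) (U : nat -> F) (W : nat -> nat -> F) 
    (n : nat) : F :=
  \sum_(c \in chains_to n) chain_weight U W c.

Lemma chain_sum_seq (F : fieldType) (U : nat -> F) (W : nat -> nat -> F) k n :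
    (0 < n <= k)%N ->
  chain_sum U W n = \sum_(c <- chains_to_seq k n) chain_weight U W c.
Proof.
by move=> nk; rewrite /chain_sum (chains_toE nk) -fsbig_seq // chains_to_seq_uniq.
Qed.

Lemma chain_weight_rcons (F : fieldType) (U : nat -> F) (W : nat -> nat -> F) c x :
    c != [::] ->
  chain_weight U W (rcons c x) = chain_weight U W c * W (last 0%N c) x.
Proof.
case: c => // a c _; rewrite /chain_weight /= -mulrA; congr (_ * _).
rewrite size_rcons big_ord_recr /=; congr (_ * _).
  apply: eq_bigr => i _; rewrite -rcons_cons !nth_rcons /=.
  by rewrite ltnS (ltnW (ltn_ord i)) ltn_ord.
by rewrite -rcons_cons !nth_rcons /= ltnSn ltnn eqxx (last_nth 0%N).
Qed.

(** The one-element chain contributes [U n]; any other chain is split before its last element. *)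
Lemma chain_sum_rec (F : fieldType) (U : nat -> F) (W : nat -> nat -> F) n :
    (0 < n)%N ->
  chain_sum U W n = U n + \sum_(d <- divisors n | d != n) chain_sum U W d * W d n.
Proof.
move=> n0; have [k nk] : exists k, (n <= k.+1)%N by exists n; apply: leqnSn.
rewrite (@chain_sum_seq _ _ _ k.+1) ?n0 //.
rewrite [chains_to_seq _ _]/= big_cons {1}/chain_weight /= big_ord0 mulr1.
rewrite big_allpairs_dep big_filter; congr (_ + _).
rewrite big_seq_cond [RHS]big_seq_cond; apply: eq_bigr => d; rewrite -dvdn_divisors //.
move=> /andP[dn dneq]; have dk : (0 < d <= k)%N.
  by rewrite (dvdn_gt0 n0 dn) -ltnS (leq_trans _ nk) // ltn_neqAle dneq dvdn_leq.
rewrite (chain_sum_seq _ _ dk) mulr_suml !big_seq; apply: eq_bigr => c.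
rewrite mem_chains_to_seq // => /andP[cs /eqP cd].
rewrite chain_weight_rcons ?cd //; apply: contraTneq dk => c0.
by rewrite -cd c0.
Qed.

(** * Inversion over divisors *)

Lemma sum_divisors_mul (V : nmodType) n (H : nat -> nat -> V) : (0 < n)%N ->
  \sum_(d <- divisors n) \sum_(f <- divisors (n %/ d)) H d (d * f)%N =
  \sum_(e <- divisors n) \sum_(d <- divisors e) H d e.
Proof.
move=> n0.
transitivity (\sum_(d <- divisors n) \sum_(e <- divisors n | (d %| e)%N) H d e).
  rewrite !big_seq; apply: eq_bigr => d; rewrite -dvdn_divisors // => dn.
  have d0 := dvdn_gt0 n0 dn.
  have q0 : (0 < n %/ d)%N by rewrite divn_gt0 // dvdn_leq.
  rewrite -(big_map (muln d) predT (H d)) -[RHS]big_filter.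
  apply: perm_big; apply: uniq_perm.
  - rewrite map_inj_uniq ?divisors_uniq // => a b /eqP.
    by rewrite eqn_pmul2l // => /eqP.
  - by rewrite filter_uniq ?divisors_uniq.
  move=> e; rewrite mem_filter -dvdn_divisors //.
  apply/mapP/andP => [[f]|[/dvdnP[f ->] fn]].
    rewrite -dvdn_divisors // => fn ->; rewrite dvdn_mulr //; split=> //.
    by rewrite -(divnK dn) mulnC dvdn_pmul2r.
  exists f; last by rewrite mulnC.
  by rewrite -dvdn_divisors // -(@dvdn_pmul2r d) // divnK.
rewrite (exchange_big_dep predT) //= !big_seq; apply: eq_bigr => e.
rewrite -dvdn_divisors // => en; rewrite -big_filter; apply: perm_big.
apply: uniq_perm; rewrite ?filter_uniq ?divisors_uniq // => d.
rewrite mem_filter -!dvdn_divisors ?(dvdn_gt0 n0 en) //.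
by apply/andP/idP => [[]//|de]; split=> //; apply: dvdn_trans en.
Qed.

(** Chains are grouped by their last element. The requirement $d_0=1$ becomes a starting weight and
    the sign is moved into the steps, so the inner sums obey [chain_sum_rec]. *)
Lemma sum_chains_from1 n (F : fieldType) (G : nat -> F) (W : nat -> nat -> F) :
    (0 < n)%N ->
  \sum_(c \in chains_from1 n) (-1) ^+ (size c).-1 * G (last 0%N c)
      * \prod_(i < (size c).-1) W (nth 0%N c i) (nth 0%N c i.+1) =
  \sum_(d <- divisors n) G d *
    chain_sum (fun h => (h == 1%N)%:R) (fun d e => - W d e) d.
Proof.
move=> n0.
pose L := [seq c | d <- divisors n,
                   c <- [seq c <- chains_to_seq n d | head 0%N c == 1%N]].
have divP d : d \in divisors n -> (0 < d <= n)%N.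
  by rewrite -dvdn_divisors // => dn; rewrite (dvdn_gt0 n0 dn) dvdn_leq.
have -> : chains_from1 n = [set` L]%classic.
  apply/seteqP; split=> c /=.
    move=> [cs ch cl]; apply/allpairsPdep; exists (last 0%N c), c.
    have cD : last 0%N c \in divisors n by rewrite -dvdn_divisors.
    by rewrite mem_filter ch eqxx mem_chains_to_seq ?divP // cs eqxx.
  move=> /allpairsPdep[d [c' [dn + ->]]]; rewrite mem_filter.
  rewrite mem_chains_to_seq ?divP // => /and3P[/eqP ch cs /eqP cl].
  by split=> //; rewrite cl dvdn_divisors.
rewrite -fsbig_seq; last first.
  apply: allpairs_uniq_dep; first exact: divisors_uniq.
    by move=> d dn; rewrite filter_uniq // chains_to_seq_uniq ?divP.
  move=> x y /allpairsPdep[d [c [/divP dP cP xE]]] /allpairsPdep[d' [c' [/divP dP' cP' yE]]].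
  rewrite xE yE /= => cE; move: cP cP'; rewrite !mem_filter !mem_chains_to_seq // cE.
  by move=> /and3P[_ _ /eqP <-] /and3P[_ _ /eqP <-].
rewrite big_allpairs_dep !big_seq; apply: eq_bigr => d dn.
rewrite (chain_sum_seq _ _ (divP d dn)) mulr_sumr big_filter big_mkcond /=.
rewrite !big_seq; apply: eq_bigr => c.
rewrite mem_chains_to_seq ?divP // => /andP[_ /eqP ->].
rewrite /chain_weight; case: eqP => _; last by rewrite mul0r mulr0.
under [in RHS]eq_bigr do rewrite -mulN1r.
by rewrite big_split /= prodr_const card_ord mul1r mulrCA mulrA.
Qed.

Theorem theorem4p2 (n : nat) (hn : (0 < n)%N) :
  tofrac (R1poly n) =
    \sum_(d \in chains_from1 n)
      (-1) ^+ (size d).-1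
      * at_Xn (Lxpoly (n %/ last 0%N d)) (last 0%N d)
      * \prod_(i < (size d).-1)
          (at_Xn (Cpoly (nth 0%N d i.+1 %/ nth 0%N d i)) (nth 0%N d i)
           / Xpow (nth 0%N d i.+1))
  /\
  tofrac (Rpoly n) =
    \sum_(d \in chains_to n)
      tofrac (Spoly (head 0%N d))
      * \prod_(i < (size d).-1)
          (at_Xn (R1poly (nth 0%N d i.+1 %/ nth 0%N d i)) (nth 0%N d i)
           / Xpow (nth 0%N d i)).
Proof.
split; last first.
  (* Both sides of the second formula satisfy the same recurrence over proper divisors. *)
  rewrite -[RHS]/(chain_sum (fun h => tofrac (Spoly h))
    (fun d e => at_Xn (R1poly (e %/ d)) d / Xpow d) n).
  have [m] := ubnP n; elim: m n hn => // m IH n n0 nm.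
  rewrite Rpoly_rec // chain_sum_rec //; congr (_ + _).
  rewrite big_seq_cond [RHS]big_seq_cond; apply: eq_bigr => d; rewrite -dvdn_divisors //.
  move=> /andP[dn dneq]; rewrite IH ?(dvdn_gt0 n0 dn) //.
  by rewrite -ltnS (leq_trans _ nm) // !ltnS ltn_neqAle dneq dvdn_leq.
rewrite (sum_chains_from1 (fun d => at_Xn (Lxpoly (n %/ d)) d)
  (fun d e => at_Xn (Cpoly (e %/ d)) d / Xpow e) hn).
(* [mu d] is the entry at $(1,d)$ of the inverse of the kernel $C_{e/d}(x^d)/x^e$. *)
set mu := chain_sum _ _.
pose H d e := at_Xn (R1poly (n %/ e)) e * (mu d * (at_Xn (Cpoly (e %/ d)) d / Xpow e)).
(* Expanding each $L^\times_{n/d}(x^d)$ over the divisors $f$ of $n/d$ gives a double sum, regrouped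
   below by $e=df$. *)
transitivity (\sum_(d <- divisors n) \sum_(f <- divisors (n %/ d)) H d (d * f)%N);
  last first.
  rewrite !big_seq; apply: eq_bigr => d; rewrite -dvdn_divisors // => dn.
  have d0 := dvdn_gt0 hn dn.
  have q0 : (0 < n %/ d)%N by rewrite divn_gt0 // dvdn_leq.
  rewrite at_Lxpoly // mulr_suml; apply: eq_bigr => f _.
  rewrite /H mulKn // divnMA [RHS]mulrC -!mulrA mulrCA; congr (_ * _).
  by rewrite mulrCA.
have muE e : (0 < e)%N ->
    \sum_(d <- divisors e) mu d * (at_Xn (Cpoly (e %/ d)) d / Xpow e) = (e == 1%N)%:R.
  move=> e0; rewrite (bigD1_seq e) ?divisors_uniq -?dvdn_divisors //=.
  (* The diagonal kernel entry is $C_1(x^e)/x^e=1$, so the recurrence for [mu e] cancels all terms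
     with $d\ne e$. *)
  have -> : Cpoly (e %/ e) = 'X by rewrite divnn e0 /Cpoly subnn expr0 mulr1.
  rewrite {1}/at_Xn comp_polyX divff ?Xpow_neq0 // mulr1 /mu chain_sum_rec // -addrA.
  rewrite -big_split /= big1 ?addr0 // => d _.
  by rewrite mulrN addNr.
rewrite sum_divisors_mul //.
transitivity (\sum_(e <- divisors n) at_Xn (R1poly (n %/ e)) e * (e == 1%N)%:R).
  rewrite (bigD1_seq 1%N) ?divisors_uniq -?dvdn_divisors ?dvd1n //= mulr1.
  rewrite divn1 at_Xn1 big1 ?addr0 // => e /negPf->; exact: mulr0.
rewrite !big_seq; apply: eq_bigr => e; rewrite -dvdn_divisors // => en.
by rewrite -muE ?(dvdn_gt0 hn en) // mulr_sumr.
Qed.
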